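(* Let $\phi=\phi_S+\phi_A$ be an NDB structure on a finite-dimensional real Lie algebra $\mathfrak{g}$. Suppose that there exists a subalgebra $\mathfrak{h}$ of $\mathfrak{g}$ such that $\mathfrak{h}$ and $\operatorname{rad}(\phi_S)$ are orthogonal with respect to $\phi_A$ and $\mathfrak{g}=\mathfrak{h}\oplus\operatorname{rad}(\phi_S)$ as a vector space. Then the following hold: (i) $\phi|_{\mathfrak{h}}=\phi_A|_{\mathfrak{h}}+\phi_S|_{\mathfrak{h}}$ is an NDB structure on $\mathfrak{h}$. (ii) $\phi_A|_{\operatorname{rad}(\phi_S)}$ is a symplectic structure on $\operatorname{rad}(\phi_S)$. (iii) There exists a homomorphism of Lie algebras $D\colon\mathfrak{h}\to\operatorname{Der}(\operatorname{rad}(\phi_S),\phi_A|_{\operatorname{rad}(\phi_S)})$ such that $\mathfrak{g}$ is isomorphic to the semidirect sum $\mathfrak{h}\ltimes_D\operatorname{rad}(\phi_S)$. (iv) Under the identification of $\mathfrak{g}$ with $\mathfrak{h}\ltimes_D\operatorname{rad}(\phi_S)$ (given by the decomposition $\mathfrak{g}=\mathfrak{h}\oplus\operatorname{rad}(\phi_S)$), $\phi$ coincides with the NDB structure given by $(x+a,y+b)\mapsto\phi|_{\mathfrak{h}}(x,y)+\phi_A|_{\operatorname{rad}(\phi_S)}(a,b)$ for $x,y\in\mathfrak{h}$, $a,b\in\operatorname{rad}(\phi_S)$.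
   Context: A bilinear form $\phi$ on a finite-dimensional real vector space $V$ is non-degenerate if $V\to V^*$, $x\mapsto\phi(x,\cdot)$, is an isomorphism. Write $\phi=\phi_S+\phi_A$ with $\phi_S$ the symmetric part and $\phi_A$ the skew-symmetric part. An NDB structure on a Lie algebra $\mathfrak{g}$ is a non-degenerate bilinear form $\phi$ on $\mathfrak{g}$ such that $\phi_A([x,y],z)+\phi_A([y,z],x)+\phi_A([z,x],y)=\phi_S(x,[y,z])$ for all $x,y,z\in\mathfrak{g}$. The radical is $\operatorname{rad}(\phi_S)=\{x\in\mathfrak{g}\mid\phi_S(x,y)=0\text{ for all }y\in\mathfrak{g}\}$; it is an ideal of $\mathfrak{g}$ when $\phi$ is an NDB structure. A symplectic structure on a Lie algebra $\mathfrak{r}$ is a non-degenerate skew-symmetric bilinear form $\omega$ with $\omega([x,y],z)+\omega([y,z],x)+\omega([z,x],y)=0$ for all $x,y,z\in\mathfrak{r}$. Put $\operatorname{Der}(\mathfrak{r},\omega)=\{A\in\operatorname{Der}(\mathfrak{r})\mid\omega(A(x),y)+\omega(x,A(y))=0\text{ for all }x,y\in\mathfrak{r}\}$. For a homomorphism $D\colon\mathfrak{h}\to\operatorname{Der}(\mathfrak{r})$, $\mathfrak{h}\ltimes_D\mathfrak{r}$ is the vector space $\mathfrak{h}\oplus\mathfrak{r}$ with bracket $[x+a,y+b]=[x,y]_{\mathfrak{h}}+[a,b]_{\mathfrak{r}}+D(x)b-D(y)a$ for $x,y\in\mathfrak{h}$, $a,b\in\mathfrak{r}$. *)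

(* Defs.v *)
From HB Require Import structures.
From mathcomp Require Import all_boot all_order all_algebra.
From mathcomp Require Import reals.

Set Implicit Arguments.
Unset Strict Implicit.
Unset Printing Implicit Defensive.

Import GRing.Theory Num.Theory.
Local Open Scope ring_scope.

HB.mixin Record isLieAlgebra (K : fieldType) (V : Type) of Vector K V := {
  lie_bracket : V -> V -> V;
  lie_linearl : forall y, linear (lie_bracket^~ y);
  lie_linearr : forall x, linear (lie_bracket x);
  lie_alternating : forall x, lie_bracket x x = 0;
  lie_jacobi : forall x y z,
    lie_bracket x (lie_bracket y z) + lie_bracket y (lie_bracket z x)
      + lie_bracket z (lie_bracket x y) = 0
}.

#[short(type="lieAlgType")]
HB.structure Definition LieAlgebra (K : fieldType) :=
  {V of isLieAlgebra K V & Vector K V}.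

Notation "[ 'lie' x , y ]" := (lie_bracket x y)
  (at level 0, x, y at level 99, format "[ 'lie'  x ,  y ]") : ring_scope.

Section LieTheory.
Variables (K : fieldType) (g : lieAlgType K).
Implicit Types x y z : g.

Lemma lieDl x y z : [lie x + y, z] = [lie x, z] + [lie y, z].
Proof. by have := lie_linearl z 1 x y; rewrite !scale1r. Qed.

Lemma lieDr x y z : [lie x, y + z] = [lie x, y] + [lie x, z].
Proof. by have := lie_linearr x 1 y z; rewrite !scale1r. Qed.

Lemma lieC x y : [lie x, y] = - [lie y, x].
Proof.
have := lie_alternating (x + y).
rewrite lieDl !lieDr !lie_alternating add0r addr0 => /eqP.
by rewrite addr_eq0 => /eqP.
Qed.

Lemma lie0l x : [lie 0, x] = 0 :> g.
Proof. by apply: (addrI [lie 0, x]); rewrite -lieDl !addr0. Qed.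

Lemma lie0r x : [lie x, 0] = 0 :> g.
Proof. by rewrite lieC lie0l oppr0. Qed.

Lemma lieZl (c : K) x y : [lie c *: x, y] = c *: [lie x, y].
Proof. by have := lie_linearl y c x 0; rewrite lie0l !addr0. Qed.

Lemma lieZr (c : K) x y : [lie x, c *: y] = c *: [lie x, y].
Proof. by have := lie_linearr x c y 0; rewrite lie0r !addr0. Qed.

Lemma lieNr x y : [lie x, - y] = - [lie x, y].
Proof. by rewrite -scaleN1r lieZr scaleN1r. Qed.

End LieTheory.

Lemma zmod_cyclic_sum0 (M : zmodType) (p q r s t u : M) :
  (p - s - (q - t)) + (q - u - (r - s)) + (r - t - (p - u)) = 0.
Proof.
have E (a b c d : M) : a - b - (c - d) = (a - c) + (d - b).
  by rewrite opprB (addrC d) addrACA (addrC (- b)).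
by rewrite !E (addrACA (p - q)) !subrKA addrACA !subrKA !subrr addr0.
Qed.

Section LieMorphisms.
Variables (K : fieldType) (g1 g2 : lieAlgType K).

Definition lie_hom (f : g1 -> g2) : Prop :=
  linear f /\ {morph f : x y / [lie x, y]}.

Definition lie_isomorphism (f : g1 -> g2) : Prop := lie_hom f /\ bijective f.

End LieMorphisms.

Record subalgebra (K : fieldType) (g : lieAlgType K) := Subalgebra {
  subalgebra_vspace :> {vspace g};
  subalgebraP : {in subalgebra_vspace &, forall x y,
    [lie x, y] \in subalgebra_vspace}
}.

Section SubalgebraLie.
Variables (K : fieldType) (g : lieAlgType K) (h : subalgebra g).

Definition sub_bracket (x y : subvs_of h) : subvs_of h :=
  Subvs (subalgebraP (subvsP x) (subvsP y)).

Fact sub_bracket_linearl y : linear (sub_bracket^~ y).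
Proof. by move=> c u v; apply: val_inj; rewrite /= lie_linearl. Qed.

Fact sub_bracket_linearr x : linear (sub_bracket x).
Proof. by move=> c u v; apply: val_inj; rewrite /= lie_linearr. Qed.

Fact sub_bracket_alternating x : sub_bracket x x = 0.
Proof. by apply: val_inj; rewrite /= lie_alternating. Qed.

Fact sub_bracket_jacobi x y z :
  sub_bracket x (sub_bracket y z) + sub_bracket y (sub_bracket z x)
    + sub_bracket z (sub_bracket x y) = 0.
Proof. by apply: val_inj; rewrite /= lie_jacobi. Qed.

HB.instance Definition _ := isLieAlgebra.Build K (subvs_of h)
  sub_bracket_linearl sub_bracket_linearr
  sub_bracket_alternating sub_bracket_jacobi.

End SubalgebraLie.

Section GeneralLinear.
Variables (K : fieldType) (V : vectType K).

Definition commutator (A B : 'End(V)) : 'End(V) := ((A \o B) - (B \o A))%VF.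

Fact commutator_linearl B : linear (commutator^~ B).
Proof.
move=> c A A'; rewrite /commutator comp_lfunDl comp_lfunDr.
by rewrite -comp_lfunZl -comp_lfunZr scalerBr opprD addrACA.
Qed.

Fact commutator_linearr A : linear (commutator A).
Proof.
move=> c B B'; rewrite /commutator comp_lfunDl comp_lfunDr.
by rewrite -comp_lfunZl -comp_lfunZr scalerBr opprD addrACA.
Qed.

Fact commutator_alternating A : commutator A A = 0.
Proof. exact: subrr. Qed.

Fact commutator_jacobi A B C :
  commutator A (commutator B C) + commutator B (commutator C A)
    + commutator C (commutator A B) = 0.
Proof.
rewrite /commutator !(comp_lfunDl, comp_lfunDr, comp_lfunNl, comp_lfunNr).
by rewrite !comp_lfunA; exact: zmod_cyclic_sum0.
Qed.

HB.instance Definition _ := isLieAlgebra.Build K 'End(V)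
  commutator_linearl commutator_linearr
  commutator_alternating commutator_jacobi.

End GeneralLinear.

Definition is_derivation (K : fieldType) (r : lieAlgType K) (A : 'End(r)) :
    Prop :=
  forall x y, A [lie x, y] = [lie A x, y] + [lie x, A y].

(* Lie algebra homomorphisms h -> Der(r), presented as homomorphisms into gl(r)
   with values in Der(r), whose bracket is the commutator. *)
Record der_hom (K : fieldType) (h r : lieAlgType K) := DerHom {
  der_hom_fun :> h -> 'End(r);
  der_homP : lie_hom der_hom_fun;
  der_hom_der : forall x, is_derivation (der_hom_fun x)
}.

(* The pair (x, a) stands for x + a with x in h and a in r. *)
Definition semidirect (K : fieldType) (h r : lieAlgType K) (D : der_hom h r) :
  Type := (h * r)%type.

Section Semidirect.
Variables (K : fieldType) (h r : lieAlgType K) (D : der_hom h r).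

HB.instance Definition _ := Vector.copy (semidirect D) (h * r)%type.

Definition semidirect_bracket (u v : semidirect D) : semidirect D :=
  ([lie u.1, v.1], [lie u.2, v.2] + D u.1 v.2 - D v.1 u.2).

Let D_linear c x y a : D (c *: x + y) a = c *: D x a + D y a.
Proof. by rewrite (der_homP D).1 !lfunE /= lfunE. Qed.

Let D_bracket x y a : D [lie x, y] a = D x (D y a) - D y (D x a).
Proof.
rewrite (der_homP D).2 {1}/lie_bracket /= /commutator.
by rewrite !lfunE /= !lfunE /= lfunE.
Qed.

Fact semidirect_alternating u : semidirect_bracket u u = 0.
Proof. by rewrite /semidirect_bracket !lie_alternating add0r subrr. Qed.

Fact semidirect_linearl v : linear (semidirect_bracket^~ v).
Proof.
move=> c [x a] [y b]; rewrite /semidirect_bracket /=; congr (_, _) => /=.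
  exact: lie_linearl.
rewrite lie_linearl D_linear linearP /=; move: (D v.1 a) (D v.1 b).
move: [lie a, v.2] [lie b, v.2] (D x v.2) (D y v.2) => p q s t d e.
by rewrite scalerBr scalerDr (addrACA (c *: p)) opprD [LHS]addrACA.
Qed.

Fact semidirect_linearr u : linear (semidirect_bracket u).
Proof.
move=> c [x a] [y b]; rewrite /semidirect_bracket /=; congr (_, _) => /=.
  exact: lie_linearr.
rewrite lie_linearr D_linear linearP /=.
by rewrite scalerBr scalerDr (addrACA (c *: [lie _, _])) opprD [LHS]addrACA.
Qed.

Fact semidirect_jacobi u v w :
  semidirect_bracket u (semidirect_bracket v w)
    + semidirect_bracket v (semidirect_bracket w u)
    + semidirect_bracket w (semidirect_bracket u v) = 0.
Proof.
case: u v w => [x a] [y b] [z c]; congr (_, _) => /=; first exact: lie_jacobi.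
have E (x' y' z' : h) (a' b' c' : r) :
    [lie a', [lie b', c'] + D y' c' - D z' b']
      + D x' ([lie b', c'] + D y' c' - D z' b') - D [lie y', z'] a'
    = [lie a', [lie b', c']]
      + ([lie a', D y' c'] - [lie a', D z' b']
         - ([lie c', D x' b'] - [lie b', D x' c']))
      + (D x' (D y' c') - D x' (D z' b')
         - (D y' (D z' a') - D z' (D y' a'))).
  rewrite !(linearB, linearD) /= D_bracket der_hom_der !lieDr lieNr.
  by rewrite (lieC (D x' b') c') !opprD !opprK !addrA.
have F (j1 m1 d1 j2 m2 d2 j3 m3 d3 : r) :
    (j1 + m1 + d1) + (j2 + m2 + d2) + (j3 + m3 + d3)
    = (j1 + j2 + j3) + (m1 + m3 + m2) + (d1 + d2 + d3).
  rewrite (addrACA (j1 + m1)) (addrACA j1) [LHS]addrACA.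
  by rewrite (addrACA (j1 + j2)) (addrAC m1).
by rewrite !E F lie_jacobi !zmod_cyclic_sum0 !addr0.
Qed.

HB.instance Definition _ := isLieAlgebra.Build K (semidirect D)
  semidirect_linearl semidirect_linearr
  semidirect_alternating semidirect_jacobi.

End Semidirect.

Definition symplectic_der (K : fieldType) (r : lieAlgType K)
    (omega : {biscalar r}) (A : 'End(r)) : Prop :=
  is_derivation A /\ forall x y, omega (A x) y + omega x (A y) = 0.

(* [nondegenerate] of [sesquilinear] is only available for hermitian forms. *)
Definition nondegenerate_form (K : fieldType) (V : vectType K)
    (f : {biscalar V}) : Prop :=
  bijective (fun x : V => linfun (f x : V -> K^o) : 'Hom(V, K^o)).

Section Parts.
Variables (K : numFieldType) (V : vectType K) (f : {biscalar V}).

Definition sym_part (x y : V) : K := (f x y + f y x) / 2.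
Definition skew_part (x y : V) : K := (f x y - f y x) / 2.

Fact sym_part_bilinear : bilinear_for *%R (idfun \; *%R) sym_part.
Proof.
by split=> u c x y; rewrite /sym_part !(linearPl, linearPr) /= mulrA -mulrDl;
  congr (_ / _); rewrite mulrDr addrACA.
Qed.

Fact skew_part_bilinear : bilinear_for *%R *%R skew_part.
Proof.
by split=> u c x y; rewrite /skew_part !(linearPl, linearPr) /= mulrA -mulrDl;
  congr (_ / _); rewrite mulrBr opprD addrACA.
Qed.

HB.instance Definition _ :=
  bilinear_isBilinear.Build K V V K *%R (idfun \; *%R)
    sym_part sym_part_bilinear.
HB.instance Definition _ :=
  bilinear_isBilinear.Build K V V K *%R *%R skew_part skew_part_bilinear.

Fact sym_part_sym x y : sym_part x y = (-1) ^+ false * idfun (sym_part y x).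
Proof. by rewrite expr0 mul1r /sym_part addrC. Qed.

HB.instance Definition _ :=
  isHermitianSesquilinear.Build K V false idfun sym_part sym_part_sym.

Definition radical : {vspace V} := orthov sym_part fullv.

End Parts.

Section Restriction.
Variables (K : fieldType) (V : vectType K) (f : {biscalar V}).
Variable U : {vspace V}.

Definition restrict_form (x y : subvs_of U) : K := f (vsval x) (vsval y).

Fact restrict_form_bilinear : bilinear_for *%R *%R restrict_form.
Proof.
by split=> u c x y; rewrite /restrict_form linearP ?(linearPl, linearPr).
Qed.

HB.instance Definition _ := bilinear_isBilinear.Build K (subvs_of U)
  (subvs_of U) K *%R *%R restrict_form restrict_form_bilinear.

End Restriction.

Arguments restrict_form {K V} f U x y.

Definition lie_cyclic_sum (K : fieldType) (g : lieAlgType K)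
    (f : g -> g -> K) (x y z : g) : K :=
  f [lie x, y] z + f [lie y, z] x + f [lie z, x] y.

Definition is_ndb (K : numFieldType) (g : lieAlgType K)
    (phi : {biscalar g}) : Prop :=
  nondegenerate_form phi /\
  forall x y z,
    lie_cyclic_sum (skew_part phi) x y z = sym_part phi x [lie y, z].

Definition is_symplectic_form (K : fieldType) (r : lieAlgType K)
    (omega : {biscalar r}) : Prop :=
  [/\ nondegenerate_form omega,
      forall x y, omega x y = - omega y x &
      forall x y z, lie_cyclic_sum omega x y z = 0].

Section Radical.
Variables (K : numFieldType) (g : lieAlgType K) (phi : {biscalar g}).
Hypothesis phi_ndb : is_ndb phi.

Lemma radicalP x : reflect (forall y, sym_part phi x y = 0) (x \in radical phi).
Proof.
apply: (iffP mem_orthovP) => [x0 y | x0 y _]; last exact: x0.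
exact/x0/memvf.
Qed.

Lemma radical_ideal x y : x \in radical phi -> [lie x, y] \in radical phi.
Proof.
move=> /radicalP x0; apply/radicalP => z; rewrite -(x0 [lie y, z]).
have -> : sym_part phi [lie x, y] z = sym_part phi z [lie x, y].
  by rewrite /sym_part addrC.
by rewrite -!phi_ndb.2 /lie_cyclic_sum -addrA addrC.
Qed.

Definition radical_subalgebra : subalgebra g :=
  Subalgebra (fun x y x_rad _ => radical_ideal y x_rad).

End Radical.

Section SemidirectForm.
Variables (K : fieldType) (h r : lieAlgType K) (D : der_hom h r).
Variables (phi : {biscalar h}) (omega : {biscalar r}).

Definition semidirect_form (u v : semidirect D) : K :=
  phi u.1 v.1 + omega u.2 v.2.

Fact semidirect_form_bilinear : bilinear_for *%R *%R semidirect_form.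
Proof.
by split=> u c x y; rewrite /semidirect_form !(linearPl, linearPr) /=
  mulrDr addrACA.
Qed.

HB.instance Definition _ := bilinear_isBilinear.Build K (semidirect D)
  (semidirect D) K *%R *%R semidirect_form semidirect_form_bilinear.

End SemidirectForm.

Arguments semidirect_form {K h r} D phi omega u v.

Definition decomposition_map (K : fieldType) (g : lieAlgType K)
    (h r : subalgebra g) (D : der_hom (subvs_of h) (subvs_of r))
    (u : semidirect D) : g :=
  vsval u.1 + vsval u.2.

Arguments decomposition_map {K g h r} D u.

(* Main.v *)
Require Import Defs.
From HB Require Import structures.
From mathcomp Require Import all_boot all_order all_algebra.
From mathcomp Require Import reals.

Set Implicit Arguments.
Unset Strict Implicit.

Import GRing.Theory Num.Theory.
Local Open Scope ring_scope.

(** The hypotheses say that [g] is the direct sum of [h] and the ideal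
    [rad = radical phi], and that [phi] is block diagonal for it: [sym_part phi]
    kills [rad] on both sides, so for [x] in [h] and [a] in [rad] both [phi x a]
    and [phi a x] are, up to sign, [skew_part phi x a = 0]. Both diagonal
    blocks of a nondegenerate block diagonal form are nondegenerate, because a
    vector in the left kernel of a block is in the left kernel of the whole form
    ([nondegenerate_restrict]). On [rad] the block is [skew_part phi], and the
    NDB identity loses its right-hand side there, which makes the block
    symplectic.

    Since [rad] is an ideal, [h] acts on it by brackets, [D x a = [x, a]]
    ([adjoint_action]); the derivation and homomorphism properties are the
    Jacobi identity, and addition is then an isomorphism from the semidirect
    sum onto [g] ([decomposition_map_iso]). The NDB identity for [x] in [h] and
    [a], [b] in [rad] reads
      [A([x, a], b) + A([a, b], x) + A([b, x], a) = S(x, [a, b])]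
    with [A] and [S] the two parts of [phi]; the right-hand side vanishes as
    [[a, b]] is in [rad], the middle term by orthogonality, and what remains
    says that [D x] preserves the symplectic form. Finally, block diagonality
    is the claim that [phi] pulls back along addition to [semidirect_form], so
    that form inherits the NDB property from [phi] ([ndb_pullback]). *)

(** * Nondegeneracy *)

Lemma linear_inj_bij (K : fieldType) (V W : vectType K) (F : {linear V -> W}) :
  dim V = dim W -> injective F -> bijective F.
Proof.
move=> dimE F_inj; pose L : 'Hom(V, W) := linfun F.
have LE : L =1 F by move=> x; rewrite lfunE.
have L0 : lker L == 0%VS by apply/lker0P => x y; rewrite !LE => /F_inj.
have L_onto : limg L = fullv.
  apply/eqP; rewrite eqEdim subvf /= !dimvf -dimE -dimvf.
  by rewrite limg_dim_eq // (eqP L0) capv0.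
exists L^-1%VF => [x | y]; first by rewrite -LE lker0_lfunK.
by rewrite -LE limg_lfunVK // L_onto memvf.
Qed.

(** [V] and its dual have the same dimension, so [x |-> f x] is bijective as
    soon as it is injective. *)
Lemma nondegenerate_formP (K : fieldType) (V : vectType K) (f : {biscalar V}) :
  nondegenerate_form f <-> forall x, (forall y, f x y = 0) -> x = 0.
Proof.
pose F (x : V) : 'Hom(V, K^o) := linfun (f x : V -> K^o).
have FE x y : F x y = f x y by rewrite lfunE.
have F_lin : linear F.
  by move=> c x y; apply/lfunP => z; rewrite add_lfunE scale_lfunE !FE linearPl.
pose F_mixin := GRing.isLinear.Build K V 'Hom(V, K^o) *:%R F F_lin.
pose Fl : {linear V -> 'Hom(V, K^o)} := HB.pack F F_mixin.
split=> [F_bij x fx0 | ker0].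
  have F_inj : injective F := bij_inj F_bij.
  by apply: F_inj; apply/lfunP => y; rewrite !FE fx0 linear0l.
apply: (@linear_inj_bij _ _ _ Fl).
  by rewrite /dim /= muln1.
move=> x y /lfunP Fxy; apply/eqP; rewrite -subr_eq0; apply/eqP/ker0 => z.
by rewrite linearBl /=; have := Fxy z; rewrite !FE => ->; rewrite subrr.
Qed.

(** A vector of [U] in the left kernel of the restriction also kills [W], hence
    everything. *)
Lemma nondegenerate_restrict (K : fieldType) (V : vectType K)
    (f : {biscalar V}) (U W : {vspace V}) :
    nondegenerate_form f -> (U + W)%VS = fullv ->
    {in U & W, forall x y, f x y = 0} ->
  nondegenerate_form (restrict_form f U).
Proof.
move=> /nondegenerate_formP f_nd UW fUW0; apply/nondegenerate_formP => x fx0.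
apply/val_inj/f_nd => y; have /memv_addP[u uU [w wW ->]] : y \in (U + W)%VS.
  by rewrite UW memvf.
rewrite linearDr /= (fUW0 _ w) ?subvsP // addr0.
by have := fx0 (Subvs uU).
Qed.

Lemma eq_nondegenerate (K : fieldType) (V : vectType K)
    (f1 f2 : {biscalar V}) :
  f1 =2 f2 -> nondegenerate_form f1 -> nondegenerate_form f2.
Proof.
move=> eqf /nondegenerate_formP f1_nd; apply/nondegenerate_formP => x fx0.
by apply: f1_nd => y; rewrite eqf.
Qed.

(** * Semidirect decompositions *)

Section AdjointAction.
Variables (K : fieldType) (g : lieAlgType K) (h r : subalgebra g).
Hypothesis h_stab : {in h & r, forall x a, [lie x, a] \in r}.

Definition adjoint_map (x : subvs_of h) (a : subvs_of r) : subvs_of r :=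
  Subvs (h_stab (subvsP x) (subvsP a)).

Fact adjoint_map_linear x : linear (adjoint_map x).
Proof. by move=> c a b; apply: val_inj; rewrite /= lie_linearr. Qed.

HB.instance Definition _ x := GRing.isLinear.Build K (subvs_of r) (subvs_of r)
  *:%R (adjoint_map x) (adjoint_map_linear x).

Definition adjoint_fun (x : subvs_of h) : 'End(subvs_of r) :=
  linfun (adjoint_map x).

(** This form of the Jacobi identity says at once that [adjoint_fun x] is a
    derivation and that [adjoint_fun] turns brackets into commutators. *)
Lemma lie_leibniz (x y z : g) :
  [lie x, [lie y, z]] = [lie [lie x, y], z] + [lie y, [lie x, z]].
Proof.
have /eqP := lie_jacobi x y z; rewrite -addrA addr_eq0 => /eqP ->.
by rewrite (lieC z x) lieNr (lieC z) opprD !opprK addrC.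
Qed.

Fact adjoint_fun_hom : lie_hom adjoint_fun.
Proof.
split=> [c x y | x y]; apply/lfunP => a; apply: val_inj.
  by rewrite add_lfunE scale_lfunE !lfunE /= lie_linearl.
rewrite [in RHS]/lie_bracket /= /commutator add_lfunE opp_lfunE !comp_lfunE /=.
by rewrite !lfunE /= lie_leibniz addrK.
Qed.

Fact adjoint_fun_der x : is_derivation (adjoint_fun x).
Proof.
move=> a b; apply: val_inj.
by rewrite !lfunE /= lie_leibniz.
Qed.

Definition adjoint_action : der_hom (subvs_of h) (subvs_of r) :=
  DerHom adjoint_fun_hom adjoint_fun_der.

Hypothesis hr_span : (h + r)%VS = fullv.
Hypothesis hr_direct : (h :&: r)%VS = 0%VS.

(** The cross terms of [[x + a, y + b]] are [[x, b] = D x b] and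
    [[a, y] = - D y a], which is how the bracket of the semidirect sum is
    defined. *)
Lemma decomposition_map_iso : lie_isomorphism (decomposition_map adjoint_action).
Proof.
split; first split.
- move=> c u v; rewrite /decomposition_map /= scalerDr.
  exact: addrACA.
- move=> [x a] [y b]; rewrite /decomposition_map /=.
  rewrite !lfunE /= !lieDl !lieDr (lieC (vsval a) (vsval y)).
  by rewrite -!addrA; congr (_ + _); rewrite addrCA; congr (_ + _); rewrite addrC.
pose split_map (z : g) : semidirect adjoint_action :=
  (vsproj h (daddv_pi h r z), vsproj r (daddv_pi r h z)).
have rh_direct : (r :&: h)%VS = 0%VS by rewrite capvC.
exists split_map => [[x a] | z]; last first.
  rewrite /decomposition_map /= !vsprojK ?memv_pi // daddv_pi_add //.
  by rewrite hr_span memvf.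
have pi0 (U W : {vspace g}) w : (U :&: W)%VS = 0%VS -> w \in W ->
    daddv_pi U W w = 0.
  move=> UW0 wW; apply: (addIr w); rewrite add0r.
  rewrite -[X in _ + X](@daddv_pi_id _ _ W U w) // 1?capvC //.
  by rewrite daddv_pi_add // (subvP (addvSr U W)).
rewrite /split_map /decomposition_map /= !linearD /=.
rewrite (daddv_pi_id hr_direct (subvsP x)) (daddv_pi_id rh_direct (subvsP a)).
rewrite (pi0 h r _ hr_direct (subvsP a)) (pi0 r h _ rh_direct (subvsP x)).
by rewrite !linear0 addr0 add0r !vsvalK.
Qed.

End AdjointAction.

(** * NDB structures *)

Section Ndb.
Variable K : numFieldType.

(** [sym_part] and [skew_part] are computed from the values of the form, so they
    pull back with it. As [f] is onto, it sends the left kernel of [psi] into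
    that of [phi], which is zero; as [f] is injective, the former is zero. *)
Lemma ndb_pullback (g1 g2 : lieAlgType K) (f : g1 -> g2)
    (psi : {biscalar g1}) (phi : {biscalar g2}) :
    lie_isomorphism f -> (forall u v, phi (f u) (f v) = psi u v) ->
  is_ndb phi -> is_ndb psi.
Proof.
move=> [[f_lin f_lie] [f' fK f'K]] phi_f [/nondegenerate_formP phi_nd phi_cyc].
split.
  apply/nondegenerate_formP => u psi0; apply: (can_inj fK).
  have -> : f u = 0.
    by apply: phi_nd => y; rewrite -(f'K y) phi_f psi0.
  by have := f_lin (-1) u u; rewrite !scaleN1r !addNr => ->.
have skewE u v : skew_part psi u v = skew_part phi (f u) (f v).
  by rewrite /skew_part -!phi_f.
move=> u v w; have := phi_cyc (f u) (f v) (f w).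
by rewrite /lie_cyclic_sum !skewE !f_lie => ->; rewrite /sym_part -!phi_f f_lie.
Qed.

(** The NDB identity on [h] is the one of [g] read on elements of [h]; only
    nondegeneracy can fail for a subalgebra. *)
Lemma ndb_restrict (g : lieAlgType K) (phi : {biscalar g}) (h : subalgebra g) :
  is_ndb phi -> nondegenerate_form (restrict_form phi h) ->
  is_ndb (restrict_form phi h).
Proof. by move=> [_ phi_cyc] phih_nd; split=> // x y z; apply: phi_cyc. Qed.

Variables (g : lieAlgType K) (phi : {biscalar g}).

Lemma form_partsE x y : phi x y = sym_part phi x y + skew_part phi x y.
Proof.
rewrite /sym_part /skew_part -mulrDl addrACA subrr addr0 -mulr2n.
by rewrite -(mulr_natr (phi x y)) mulfK // pnatr_eq0.
Qed.

Lemma skew_partC x y : skew_part phi x y = - skew_part phi y x.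
Proof. by rewrite /skew_part -mulNr opprB. Qed.

Lemma sym_part_radicalr x a : a \in radical phi -> sym_part phi x a = 0.
Proof. by move=> /radicalP a0; rewrite -(a0 x) /sym_part addrC. Qed.

End Ndb.

Unset Implicit Arguments.
Set Strict Implicit.

Theorem theorem4p2 (R : realType) (g : lieAlgType R) (phi : {biscalar g})
    (phi_ndb : is_ndb phi) (h : subalgebra g)
    (h_rad_orth : {in h & radical phi, forall x a, skew_part phi x a = 0})
    (h_rad_span : (h + radical phi)%VS = fullv)
    (h_rad_direct : directv (h + radical phi)) :
  let rad := radical_subalgebra phi_ndb in
  let phi_h := restrict_form phi h in
  let omega := restrict_form (skew_part phi) rad in
  [/\ is_ndb phi_h,
      is_symplectic_form omega &
      exists D : der_hom (subvs_of h) (subvs_of rad),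
        [/\ (forall x, symplectic_der omega (D x)),
            lie_isomorphism (decomposition_map D),
            is_ndb (semidirect_form D phi_h omega) &
            forall u v : semidirect D,
              phi (decomposition_map D u) (decomposition_map D v) =
                semidirect_form D phi_h omega u v]].
Proof.
move=> rad phi_h omega.
have [phi_nd phi_cyc] := phi_ndb.
have phiE_rad x a : a \in radical phi -> phi x a = skew_part phi x a.
  by move=> a_rad; rewrite form_partsE sym_part_radicalr ?add0r.
have phi_h_rad : {in h & radical phi, forall x a, phi x a = 0}.
  by move=> x a xh a_rad; rewrite phiE_rad ?h_rad_orth.
have phi_rad_h : {in radical phi & h, forall a x, phi a x = 0}.
  move=> a x a_rad xh; rewrite form_partsE (elimT (radicalP _ _) a_rad) add0r.
  by rewrite skew_partC h_rad_orth ?oppr0.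
have omega_phi : restrict_form phi rad =2 omega.
  by move=> a b; apply: phiE_rad; apply: (subvsP b).
have h_stab : {in h & rad, forall x a, [lie x, a] \in rad}.
  move=> x a _ a_rad; rewrite lieC memvN; exact: (radical_ideal phi_ndb).
pose D := adjoint_action h_stab.
have dec_iso : lie_isomorphism (decomposition_map D).
  by apply: decomposition_map_iso => //; apply/directv_addP.
have dec_form (u v : semidirect D) :
    phi (decomposition_map D u) (decomposition_map D v) =
      semidirect_form D phi_h omega u v.
  rewrite /decomposition_map linearDl !linearDr /=.
  rewrite (phi_h_rad _ _ (subvsP u.1) (subvsP v.2)).
  rewrite (phi_rad_h _ _ (subvsP u.2) (subvsP v.1)) addr0 add0r.
  congr (_ + _); exact: omega_phi.
split.
- exact: ndb_restrict (nondegenerate_restrict phi_nd h_rad_span phi_h_rad).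
- split.
  + apply: eq_nondegenerate omega_phi _.
    apply: (nondegenerate_restrict phi_nd _ phi_rad_h).
    by rewrite addvC.
  + by move=> a b; apply: skew_partC.
  + move=> a b c; rewrite [LHS]phi_cyc.
    exact: (elimT (radicalP _ _) (subvsP a)).
exists D; split=> //; last exact: ndb_pullback dec_iso dec_form phi_ndb.
move=> x; split=> [|a b]; first exact: der_hom_der.
rewrite /omega /restrict_form !lfunE /=.
have ab_rad : [lie vsval a, vsval b] \in radical phi.
  exact: (subalgebraP (subvsP a) (subvsP b)).
(* The only term of the cyclic sum that pairs [h] with [rad] drops out. *)
have := phi_cyc (vsval x) (vsval a) (vsval b).
rewrite sym_part_radicalr // /lie_cyclic_sum.
rewrite (skew_partC _ [lie vsval a, _]) (h_rad_orth _ _ (subvsP x) ab_rad).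
rewrite oppr0 addr0.
by rewrite (skew_partC _ (vsval a)) (lieC (vsval b)) linearNl.
Qed.
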